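(* In the setting of the context, suppose the states $(\sigma,u)$ and the upwind states $(\sigma^*,u^* )$ satisfy the Godunov relation $$\mathbf F^*(\sigma,u,\sigma^*,u^* )\mathbf n=\mathbf F(\sigma^*,u^* )\mathbf n .$$ Assume that one of the following holds. (F.1) (a) There exists an invertible matrix $\Phi\in\mathbb R^{m^u,m^u}$ such that $B\Phi\,\mathcal A^{u\sigma}=\mathcal A^{\sigma\sigma}$; (b) there exists a matrix $\Psi\in\mathbb R^{m^u,m^u}$ such that $\mathcal A^{\sigma u}=B\Psi$; and (c) $\bigcap_{k=1}^d\mathrm{Range}(B_k)=\{\mathbf 0\}$ and $\mathcal N(B_k)=\{\mathbf 0\}$ for all $k=1,\dots,d$. (F.2) $\mathcal A^{\sigma u}=0$. Then the upwind numerical flux can be expressed as a function of $(\sigma,u,u^* )$ only (i.e. without $\sigma^*$): $$\mathbf F^*\mathbf n=\begin{bmatrix}B u^*\\ B^T\sigma+Cu+T(u-u^* )\end{bmatrix},$$ where $$T=-\big(\Phi^TB^TB\Phi\big)^{-1}\Phi^TB^TB(\Psi+I_{m^u})+\mathcal A^{uu}$$ if (F.1) holds, and $T=\mathcal A^{uu}$ if (F.2) holds.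
   Context: Two-field structure: $m=m^\sigma+m^u$ with positive integers $m^\sigma,m^u$. For $k=1,\dots,d$ the coefficient matrices of the Friedrichs' system $\sum_k\partial_k(A_k\mathbf z)+G\mathbf z=\mathbf f$, $\mathbf z=(\sigma,u)\in\mathbb R^{m^\sigma}\times\mathbb R^{m^u}$, are symmetric and have the block form $A_k=\begin{bmatrix}0&B_k\\ B_k^T&C_k\end{bmatrix}$ with $B_k$ of size $m^\sigma\times m^u$ and $C_k$ of size $m^u\times m^u$. For the unit outward normal $\mathbf n=(n_1,\dots,n_d)^T$ of an element boundary (at a point of it), put $A=\sum_kn_kA_k$, $B=\sum_kn_kB_k$, $C=\sum_kn_kC_k$, so $A=\begin{bmatrix}0&B\\ B^T&C\end{bmatrix}$. $|A|=R|\Lambda|R^{-1}$, where $A=R\Lambda R^{-1}$ is an eigendecomposition of the symmetric matrix $A$, and $|A|$ is written in blocks $|A|=\begin{bmatrix}\mathcal A^{\sigma\sigma}&\mathcal A^{\sigma u}\\ \mathcal A^{u\sigma}&\mathcal A^{uu}\end{bmatrix}$ of sizes conforming to $(m^\sigma,m^u)$. $\mathcal N(\cdot)$ denotes the null space and $I_{m^u}$ is the $m^u\times m^u$ identity. Physical normal flux: $\mathbf F(\sigma,u)\mathbf n=A\begin{bmatrix}\sigma\\ u\end{bmatrix}$. Upwind (Godunov) numerical flux in one-sided form, with interior state $(\sigma,u)$ and upwind state $(\sigma^*,u^* )$: $\mathbf F^*(\sigma,u,\sigma^*,u^* )\mathbf n=A\begin{bmatrix}\sigma\\ u\end{bmatrix}+|A|\begin{bmatrix}\sigma-\sigma^*\\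 u-u^*\end{bmatrix}$. In the Godunov approach the upwind states satisfy $\mathbf F^*(\sigma,u,\sigma^*,u^* )\mathbf n=\mathbf F(\sigma^*,u^* )\mathbf n$.
   Formalization: For d ≥ 3, (F.1) does not make Φ^T B^T BΦ invertible, so the displayed T can be undefined; the formal version gives the reduced flux with some T for all d, equal to the stated T whenever that inverse exists, and proves it exists for d ≤ 2. *)

(* Defs.v *)
From HB Require Import structures.
From mathcomp Require Import all_boot all_order all_algebra.
From mathcomp Require Import reals.

Set Implicit Arguments.
Unset Strict Implicit.
Unset Printing Implicit Defensive.

Import Order.TTheory GRing.Theory Num.Theory.
Local Open Scope ring_scope.

Section LinearAlgebra.
Variables (R : realType) (m p : nat).

Definition in_range (M : 'M[R]_(m, p)) (y : 'cV[R]_m) : Prop :=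
  exists x : 'cV[R]_p, y = M *m x.

Definition trivial_null (M : 'M[R]_(m, p)) : Prop :=
  forall x : 'cV[R]_p, M *m x = 0 -> x = 0.

Definition eigendecomposition (A Q : 'M[R]_m) (lam : 'rV[R]_m) : Prop :=
  Q \in unitmx /\ A = Q *m diag_mx lam *m invmx Q.

(* |A| = Q |Lambda| Q^-1; meaningful when (Q, lam) is an eigendecomposition of
   A, and then independent of the chosen eigendecomposition. *)
Definition abs_mx (Q : 'M[R]_m) (lam : 'rV[R]_m) : 'M[R]_m :=
  Q *m diag_mx (map_mx (fun x : R => `|x|) lam) *m invmx Q.

End LinearAlgebra.

Section TwoField.
Variables (R : realType) (d ms mu : nat).

Definition coef_mx (B : 'M[R]_(ms, mu)) (C : 'M[R]_mu) : 'M[R]_(ms + mu) :=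
  block_mx 0 B B^T C.

Definition normal_comb (m p : nat) (n : 'cV[R]_d)
    (M : 'I_d -> 'M[R]_(m, p)) : 'M[R]_(m, p) :=
  \sum_(k < d) n k 0 *: M k.

Definition normal_mx (n : 'cV[R]_d)
    (B : 'I_d -> 'M[R]_(ms, mu)) (C : 'I_d -> 'M[R]_mu) : 'M[R]_(ms + mu) :=
  normal_comb n (fun k => coef_mx (B k) (C k)).

Definition phys_flux (A : 'M[R]_(ms + mu))
    (s : 'cV[R]_ms) (u : 'cV[R]_mu) : 'cV[R]_(ms + mu) :=
  A *m col_mx s u.

(* absA stands for |A|; (s, u) is the interior state, (s', u') the upwind one. *)
Definition upwind_flux (A absA : 'M[R]_(ms + mu))
    (s : 'cV[R]_ms) (u : 'cV[R]_mu) (s' : 'cV[R]_ms) (u' : 'cV[R]_mu) :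
    'cV[R]_(ms + mu) :=
  A *m col_mx s u + absA *m col_mx (s - s') (u - u').

Definition godunov (A absA : 'M[R]_(ms + mu))
    (s : 'cV[R]_ms) (u : 'cV[R]_mu) (s' : 'cV[R]_ms) (u' : 'cV[R]_mu) : Prop :=
  upwind_flux A absA s u s' u' = phys_flux A s' u'.

(* The form of the upwind flux that does not involve s'. *)
Definition reduced_flux (B : 'M[R]_(ms, mu)) (C T : 'M[R]_mu)
    (s : 'cV[R]_ms) (u u' : 'cV[R]_mu) : 'cV[R]_(ms + mu) :=
  col_mx (B *m u') (B^T *m s + C *m u + T *m (u - u')).

(* The blocks of absA are ss = ulsubmx, su = ursubmx, us = dlsubmx and
   uu = drsubmx. *)
Definition cond_F1 (Bk : 'I_d -> 'M[R]_(ms, mu)) (B : 'M[R]_(ms, mu))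
    (absA : 'M[R]_(ms + mu)) (Phi Psi : 'M[R]_mu) : Prop :=
  [/\ Phi \in unitmx /\ B *m Phi *m dlsubmx absA = ulsubmx absA,
      ursubmx absA = B *m Psi
    & (forall y : 'cV[R]_ms, (forall k, in_range (Bk k) y) -> y = 0)
      /\ (forall k, trivial_null (Bk k))].

Definition cond_F2 (absA : 'M[R]_(ms + mu)) : Prop := ursubmx absA = 0.

Definition gram_F1 (B : 'M[R]_(ms, mu)) (Phi : 'M[R]_mu) : 'M[R]_mu :=
  Phi^T *m B^T *m B *m Phi.

Definition T_F1 (B : 'M[R]_(ms, mu)) (absA : 'M[R]_(ms + mu))
    (Phi Psi : 'M[R]_mu) : 'M[R]_mu :=
  - (invmx (gram_F1 B Phi) *m (Phi^T *m B^T *m B *m (Psi + 1%:M)))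
  + drsubmx absA.

Definition T_F2 (absA : 'M[R]_(ms + mu)) : 'M[R]_mu := drsubmx absA.

End TwoField.

(* Main.v *)
Require Import Defs.
From HB Require Import structures.
From mathcomp Require Import all_boot all_order all_algebra.
From mathcomp Require Import reals.

Import Order.TTheory GRing.Theory Num.Theory.
Local Open Scope ring_scope.

(** Write [a = s - s'] and [b = u - u'] for the jumps, and [Ass], [Asu], [Aus],
    [Auu] for the blocks of [|A|].  The Godunov relation
    says that [(A + |A|) (a, b) = 0].  Since the flux is then [A (s', u')], its
    first block is [B u'] because the corner block of [A] vanishes.  The second
    block is [B^T s + C u + Aus a + Auu b], so removing [s'] amounts to writing
    [Aus a] as a linear function of [b] on the kernel of [A + |A|]
    ([upwind_flux_reduced]); this comes from the first block row
    [Ass a + (B + Asu) b = 0].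

    The needed fact about [|A|] is that it is a Gram matrix [S^T S]
    ([abs_mx_gram]).  In particular it is symmetric, so under (F.2) [Aus]
    vanishes with [Asu]; and the row space of [Aus] lies in that of [Ass]
    ([gram_block_submx]), so [Aus = K Ass] for some [K], whence
    [Aus a = - K (B + Asu) b].  This settles the existence of [T] even when
    [B] is not injective.

    Under (F.1) the first block row reads
    [B (Phi Aus a + (Psi + 1) b) = 0]; multiplying by [Phi^T B^T] gives the
    normal equations [G Aus a = - Phi^T B^T B (Psi + 1) b] with [G] the Gram
    matrix of [B Phi], and these determine the stated [T] when [G] is
    invertible.  For at most two space dimensions [G] is invertible because [B]
    is injective: if [B x = 0], the two terms [n_k B_k x] are opposite, hence lie
    in both ranges, hence vanish ([normal_comb_trivial_null]). *)

(** * Gram matrices over the reals *)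

Lemma gram_eq0 (R : realType) (m p : nat) (M : 'M[R]_(m, p)) :
  M^T *m M = 0 -> M = 0.
Proof.
move=> M0; apply/matrixP => i j; rewrite mxE.
have /eqP := congr1 (fun N : 'M_p => N j j) M0; rewrite !mxE.
under eq_bigr do rewrite mxE -expr2.
rewrite psumr_eq0 => [/allP/(_ i)|k _]; last exact: sqr_ge0.
by rewrite mem_index_enum sqrf_eq0 => /(_ isT)/eqP.
Qed.

(** Dually, [M] kills every vector [x] that its Gram matrix kills, because
    [x^T M^T M x] is the square norm of [M x]. *)
Lemma gram_submx (R : realType) (m p : nat) (M : 'M[R]_(m, p)) :
  (M <= M^T *m M)%MS.
Proof.
rewrite submxE; apply/eqP/gram_eq0.
by rewrite trmx_mul -!mulmxA [M^T *m (M *m _)]mulmxA mulmx_coker mulmx0.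
Qed.

Lemma trivial_null_row_full (R : realType) (m p : nat) (M : 'M[R]_(m, p)) :
  trivial_null M -> row_full M.
Proof.
move=> Minj; rewrite -sub1mx submxE mul1mx; apply/eqP/matrixP => i j.
have /colP/(_ i) : col j (cokermx M) = 0.
  by apply: Minj; rewrite colE mulmxA mulmx_coker mul0mx.
by rewrite !mxE.
Qed.

Lemma gram_unitmx (R : realType) (m p : nat) (M : 'M[R]_(m, p)) :
  trivial_null M -> M^T *m M \in unitmx.
Proof.
move=> /trivial_null_row_full Mfull; rewrite -row_full_unit -sub1mx.
by apply: submx_trans (gram_submx _ _ _ _); rewrite sub1mx.
Qed.

(** For a block matrix this is the general fact that a vector at which a
    positive semidefinite form vanishes lies in the kernel of the form, applied
    to vectors supported in the first block. *)
Lemma gram_block_submx (R : realType) (m p q : nat) (S : 'M[R]_(m, p + q)) :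
  (dlsubmx (S^T *m S) <= ulsubmx (S^T *m S))%MS.
Proof.
rewrite -(hsubmxK S) tr_row_mx mul_col_row block_mxKul block_mxKdl.
exact: submx_trans (submxMl _ _) (gram_submx _ _ _ _).
Qed.

(** * The absolute value of a symmetric matrix *)

(** The eigenvectors in [Q] need not be orthonormal, but symmetry makes
    [Q^T Q] commute with [Lambda]: eigenvectors for distinct eigenvalues are
    orthogonal.  So [Q^T Q] commutes with every function of [Lambda], and this is
    symmetry of the function of the matrix. *)
Lemma eigen_fun_sym (R : realType) (m : nat) (A Q : 'M[R]_m) (lam : 'rV[R]_m)
    (f : R -> R) :
  A^T = A -> eigendecomposition A Q lam ->
  let fA := Q *m diag_mx (map_mx f lam) *m invmx Q in fA^T = fA.
Proof.
move=> Asym [Qu AE] /=.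
have Qtu : Q^T \in unitmx by rewrite unitmx_tr.
have conjE (D : 'rV[R]_m) :
    ((Q *m diag_mx D *m invmx Q)^T = Q *m diag_mx D *m invmx Q) <->
    (Q^T *m Q *m diag_mx D = diag_mx D *m (Q^T *m Q)).
  rewrite !trmx_mul tr_diag_mx trmx_inv.
  split=> [/(congr1 (fun N => Q^T *m N *m Q))|H].
    by rewrite !mulmxA mulmxV // mul1mx mulmxKV // => <-.
  apply: (can_inj (mulKmx Qtu)); apply: (can_inj (mulmxK Qu)).
  by rewrite !mulmxA mulmxV // mul1mx mulmxKV // H -!mulmxA.
apply/conjE.
have : Q^T *m Q *m diag_mx lam = diag_mx lam *m (Q^T *m Q).
  by apply/conjE; rewrite -AE.
rewrite !mul_mx_diag !mul_diag_mx => comm; apply/matrixP => i j.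
move/matrixP/(_ i j): comm; rewrite !mxE.
set g := \sum_(_ < _) _; rewrite ![_ * g]mulrC => gE.
have [-> | g0] := eqVneq g 0; first by rewrite !mul0r.
by rewrite (mulfI g0 gE).
Qed.

Lemma abs_mx_gram (R : realType) (m : nat) (A Q : 'M[R]_m) (lam : 'rV[R]_m) :
  A^T = A -> eigendecomposition A Q lam ->
  exists S : 'M[R]_m, abs_mx Q lam = S^T *m S.
Proof.
move=> Asym AE; have [Qu _] := AE.
(* the symmetric square root of the absolute value *)
pose r (x : R) := Num.sqrt `|x|.
exists (Q *m diag_mx (map_mx r lam) *m invmx Q).
rewrite (eigen_fun_sym _ _ _ _ _ r Asym AE) !mulmxA mulmxKV //.
rewrite -(mulmxA Q) mulmx_diag /abs_mx; congr (_ *m diag_mx _ *m _).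
by apply/rowP => i; rewrite !mxE -expr2 sqr_sqrtr.
Qed.

(** * Normal combinations of the coefficient matrices *)

Lemma normal_mxE (R : realType) (d ms mu : nat) (n : 'cV[R]_d)
    (Bk : 'I_d -> 'M[R]_(ms, mu)) (Ck : 'I_d -> 'M[R]_mu) :
  normal_mx n Bk Ck = coef_mx (normal_comb n Bk) (normal_comb n Ck).
Proof.
have blockE k : n k 0 *: coef_mx (Bk k) (Ck k)
    = block_mx 0 (n k 0 *: Bk k) (n k 0 *: (Bk k)^T) (n k 0 *: Ck k).
  by rewrite scale_block_mx scaler0.
rewrite /normal_mx /normal_comb (eq_bigr _ (fun k _ => blockE k)).
rewrite -[LHS]submxK /coef_mx /ulsubmx /ursubmx /dlsubmx /drsubmx.
rewrite !linear_sum /=; congr block_mx.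
- by apply: big1 => k _; exact: block_mxKul.
- by apply: eq_bigr => k _; exact: block_mxKur.
- by apply: eq_bigr => k _; rewrite /= linearZ; exact: block_mxKdl.
- by apply: eq_bigr => k _; exact: block_mxKdr.
Qed.

Lemma normal_comb_sym (R : realType) (d m : nat) (n : 'cV[R]_d)
    (M : 'I_d -> 'M[R]_m) :
  (forall k, (M k)^T = M k) -> (normal_comb n M)^T = normal_comb n M.
Proof.
move=> Msym; rewrite raddf_sum; apply: eq_bigr => k _.
by rewrite /= linearZ /= Msym.
Qed.

(** In a null vector [x] of the combination the term of one index with
    [n_k != 0] is minus the sum of the others; with at most one other index this
    puts the term in all ranges at once. *)
Lemma normal_comb_trivial_null (R : realType) (d m p : nat) (n : 'cV[R]_d)
    (M : 'I_d -> 'M[R]_(m, p)) :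
  (d <= 2)%N -> n != 0 ->
  (forall y : 'cV[R]_m, (forall k, in_range (M k) y) -> y = 0) ->
  (forall k, trivial_null (M k)) ->
  trivial_null (normal_comb n M).
Proof.
move=> d2 /cV0Pn[k nk0] capM Minj x.
rewrite /normal_comb mulmx_suml (bigD1 k) //= => Mx0.
apply: (Minj k); apply: (scalerI nk0); rewrite scaler0 scalemxAl.
apply: capM => j; have [->|jk] := eqVneq j k.
  by exists (n k 0 *: x); rewrite -scalemxAl -scalemxAr.
exists (- (n j 0 *: x)); rewrite mulmxN -scalemxAr.
move: Mx0; rewrite (bigD1 j) //= big1 => [|i /andP[ik ij]].
  by rewrite addr0 scalemxAl => /eqP; rewrite addr_eq0 => /eqP.
(* a third index [i] would contradict [d <= 2] *)
have : (#|[set i; j; k]| <= d)%N by rewrite -[leqRHS]card_ord max_card.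
rewrite -setUA cardsU1 cards2 !inE negb_or ij ik jk.
by move=> /leq_trans/(_ d2).
Qed.

(** * Elimination of the upwind variable *)

(** The premise on [a] and [b] is the first block row of
    [(A + |A|) (a, b) = 0], and [T0 b] then replaces the only term of the flux
    in which [s'] survives. *)
Lemma upwind_flux_reduced (R : realType) (ms mu : nat)
    (B : 'M[R]_(ms, mu)) (C T0 : 'M[R]_mu) (absA : 'M[R]_(ms + mu)) :
  (forall (a : 'cV[R]_ms) (b : 'cV[R]_mu),
     ulsubmx absA *m a + (B + ursubmx absA) *m b = 0 ->
     dlsubmx absA *m a = T0 *m b) ->
  forall s u s' u', godunov (coef_mx B C) absA s u s' u' ->
    upwind_flux (coef_mx B C) absA s u s' u'
    = reduced_flux B C (T0 + drsubmx absA) s u u'.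
Proof.
move=> elim_a s u s' u'.
rewrite /godunov /reduced_flux /phys_flux /upwind_flux -{1 2}(submxK absA).
rewrite !mul_block_col !mul0mx !add0r add_col_mx => /eq_col_mx[top _].
congr col_mx; first exact: top.
rewrite (elim_a _ (u - u')) ?mulmxDl //.
by rewrite [B *m (_ - _)]mulmxBr addrCA addrAC top subrr.
Qed.

(* For d >= 3 condition (F.1)(c) does not make B injective, so gram_F1 B Phi
   can be singular and the formula for T undefined (invmx returns a singular
   matrix unchanged).  The reduced form of the flux still holds then, with some
   T that does not depend on the states; T is the stated matrix as soon as the
   inverse in it exists, and for d <= 2 it always does. *)
Theorem lemma3p5 (R : realType) (d ms mu : nat)
    (ms_gt0 : (0 < ms)%N) (mu_gt0 : (0 < mu)%N)
    (Bk : 'I_d -> 'M[R]_(ms, mu)) (Ck : 'I_d -> 'M[R]_mu)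
    (Ak_sym : forall k, (coef_mx (Bk k) (Ck k))^T = coef_mx (Bk k) (Ck k))
    (n : 'cV[R]_d) (n_unit : \sum_(k < d) n k 0 ^+ 2 = 1)
    (Q : 'M[R]_(ms + mu)) (lam : 'rV[R]_(ms + mu))
    (A_eig : eigendecomposition (normal_mx n Bk Ck) Q lam) :
  let A := normal_mx n Bk Ck in
  let B := normal_comb n Bk in
  let C := normal_comb n Ck in
  let absA := abs_mx Q lam in
  (forall Phi Psi : 'M[R]_mu, cond_F1 Bk B absA Phi Psi ->
     exists T : 'M[R]_mu,
       [/\ forall s u s' u', godunov A absA s u s' u' ->
             upwind_flux A absA s u s' u' = reduced_flux B C T s u u',
           gram_F1 B Phi \in unitmx -> T = T_F1 B absA Phi Psi
         & (d <= 2)%N -> gram_F1 B Phi \in unitmx])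
  /\
  (cond_F2 absA ->
     forall s u s' u', godunov A absA s u s' u' ->
       upwind_flux A absA s u s' u' = reduced_flux B C (T_F2 absA) s u u').
Proof.
move=> A B C absA.
have AE : A = coef_mx B C := normal_mxE _ _ _ _ n Bk Ck.
have Asym : A^T = A by apply: normal_comb_sym.
have [S absE] := abs_mx_gram _ _ A Q lam Asym A_eig.
rewrite -/absA in absE.
rewrite AE; split=> [Phi Psi [[Phi_u ssE] suE [capB injB]] | su0 s u s' u' god].
- have unit_d2 : (d <= 2)%N -> gram_F1 B Phi \in unitmx.
    move=> d2.
    have n0 : n != 0.
      apply: contra_eq_neq n_unit => ->.
      by rewrite big1 ?[0 == 1]eq_sym ?oner_neq0 // => k _; rewrite mxE expr0n.
    have Binj := normal_comb_trivial_null _ _ _ _ n Bk d2 n0 capB injB.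
    rewrite /gram_F1 -trmx_mul -mulmxA; apply: gram_unitmx => x.
    rewrite -mulmxA => /Binj Phix0.
    by apply: (can_inj (mulKmx Phi_u)); rewrite Phix0 mulmx0.
  have [Gu | Gnu] := boolP (gram_F1 B Phi \in unitmx).
    exists (T_F1 B absA Phi Psi); split=> //.
    apply: upwind_flux_reduced => a b; rewrite -ssE suE.
    have -> : B + B *m Psi = B *m (Psi + 1%:M) by rewrite mulmxDr mulmx1 addrC.
    (* [B Phi] may be tall; projecting on its columns makes the system square *)
    move/(congr1 (mulmx (Phi^T *m B^T))).
    rewrite mulmx0 mulmxDr !mulmxA -/(gram_F1 B Phi) => normal_eq.
    apply: (can_inj (mulKmx Gu)).
    rewrite mulNmx mulmxN !mulmxA mulmxV // mul1mx.
    by apply/eqP; rewrite -addr_eq0 normal_eq.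
  have /submxP[K usE] : (dlsubmx absA <= ulsubmx absA)%MS.
    by rewrite absE gram_block_submx.
  exists (- (K *m (B + ursubmx absA)) + drsubmx absA); split=> //.
    apply: upwind_flux_reduced => a b /eqP; rewrite addr_eq0 => /eqP ssa.
    by rewrite usE -mulmxA ssa mulmxN mulNmx mulmxA.
  by move/unit_d2; rewrite (negPf Gnu).
- rewrite -[T_F2 absA]add0r; apply: upwind_flux_reduced god => a b _.
  have abs_sym : absA^T = absA by rewrite absE trmx_mul trmxK.
  by rewrite -abs_sym -trmx_ursub su0 trmx0 !mul0mx.
Qed.
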